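(* Let $X$ be a real Banach space with property $(\overline{\mathrm{P1}})$. Then every (closed) subspace $Y$ of $X$ that is an ideal in $X$ has property $(\overline{\mathrm{P1}})$.
   Context: A subspace $Y$ of a real Banach space $X$ is an ideal in $X$ if $Y^\perp$, the annihilator of $Y$ in $X^*$, is the kernel of a norm one linear projection on $X^*$. For a Banach space $X$, $B_X$ is the closed unit ball. For $f\in B_{X^*}$ and $\varepsilon>0$, the slice of $B_X$ is $S(B_X,f,\varepsilon)=\{x\in B_X:\ \mathrm{Re}\, f(x)>\sup_{c\in B_X}|f(c)|-\varepsilon\}$. A convex combination of slices of $B_X$ is a set $\sum_{i=1}^n\lambda_i S_i=\{\sum_{i=1}^n \lambda_i x_i: x_i\in S_i\}$ with $n\in\mathbb{N}$, $\lambda_i>0$, $\sum_{i=1}^n\lambda_i=1$ and each $S_i$ a slice of $B_X$. $X$ has property $(\overline{\mathrm{P1}})$ if for every convex combination of slices $C$ of $B_X$ and every $x\in C$ there exists a relatively weakly open subset $W$ of $B_X$ with $x\in W\subseteq\overline{C}$ (norm closure). *)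

(* Defs.v *)
From HB Require Import structures.
From mathcomp Require Import all_boot all_order all_algebra.
From mathcomp Require Import all_classical all_reals all_analysis.
Import Order.TTheory GRing.Theory Num.Theory.
Import numFieldNormedType.Exports.

Set Implicit Arguments.
Unset Strict Implicit.
Unset Printing Implicit Defensive.

Local Open Scope classical_set_scope.
Local Open Scope ring_scope.

Definition unit_ball (R : realType) (V : normedModType R) : set V :=
  [set x | `|x| <= 1].
Arguments unit_ball {R} V.

(* [sup] is real-valued and is 0 on sets that are not bounded above: for linear
   [f] this is the usual operator norm when [f] is bounded, and 0 otherwise. *)
Definition opnorm (R : realType) (V W : normedModType R) (f : V -> W) : R :=
  sup [set `|f x| | x in unit_ball V].

Lemma opnorm_ub (R : realType) (V W : normedModType R) (f : {linear V -> W})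
  (x : V) : continuous f -> unit_ball V x -> `|f x| <= opnorm f.
Proof.
move=> /linear_bounded_continuous /bounded_funP /(_ 1) [M fM] x1.
apply: ub_le_sup; last by exists x.
by exists M => _ [y y1 <-]; exact: fM.
Qed.

Lemma opnorm_le (R : realType) (V W : normedModType R) (f : V -> W) (M : R) :
  (forall x, unit_ball V x -> `|f x| <= M) -> opnorm f <= M.
Proof.
move=> fM; apply: ge_sup; last by move=> _ [x x1 <-]; exact: fM.
by exists `|f 0|, 0 => //; rewrite /unit_ball /= normr0.
Qed.

Definition dual_pred (R : realType) (V : normedModType R) : {pred V -> R^o} :=
  [pred f | `[< linear f /\ continuous f >]].

Lemma dual_submod_closed (R : realType) (V : normedModType R) :
  submod_closed (@dual_pred R V).
Proof.
split; first by apply/asboolP; split=> [a x y|x];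
  [rewrite scaler0 addr0 | exact: cvg_cst].
move=> a f g /asboolP[lf cf] /asboolP[lg cg]; apply/asboolP; split=> [b x y|x].
  by rewrite /= !fctE lf lg !scalerDr addrACA !scalerA (mulrC a b).
by apply: cvgD; [apply: cvgZr; exact: cf|exact: cg].
Qed.

HB.instance Definition _ (R : realType) (V : normedModType R) :=
  GRing.isSubmodClosed.Build R (V -> R^o) (@dual_pred R V)
    (@dual_submod_closed R V).

Record dual (R : realType) (V : normedModType R) := Dual {
  dual_fun :> V -> R^o ;
  dual_funP : dual_fun \in @dual_pred R V }.

HB.instance Definition _ (R : realType) (V : normedModType R) :=
  [isSub for @dual_fun R V].
HB.instance Definition _ (R : realType) (V : normedModType R) :=
  [Choice of dual V by <:].
HB.instance Definition _ (R : realType) (V : normedModType R) :=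
  [SubChoice_isSubLmodule of dual V by <:].

Lemma dual_linear (R : realType) (V : normedModType R) (f : dual V) : linear f.
Proof. by case: f => f /= /asboolP[]. Qed.

HB.instance Definition _ (R : realType) (V : normedModType R) (f : dual V) :=
  GRing.isLinear.Build R V R^o _ (dual_fun f) (@dual_linear R V f).

Lemma dual_continuous (R : realType) (V : normedModType R) (f : dual V) :
  continuous f.
Proof. by case: f => f /= /asboolP[]. Qed.

Section dual_norm.
Variables (R : realType) (V : normedModType R).
Implicit Types f g : dual V.

Let dnorm f : R := opnorm f.

Let dnorm_ub f x : unit_ball V x -> `|f x| <= dnorm f.
Proof. by apply: opnorm_ub; exact: dual_continuous. Qed.

Let dnormD f g : dnorm (f + g) <= dnorm f + dnorm g.
Proof.
apply: opnorm_le => x x1.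
by rewrite (le_trans (ler_normD _ _))// lerD// dnorm_ub.
Qed.

Let dnormZ_le (a : R) f : dnorm (a *: f) <= `|a| * dnorm f.
Proof.
apply: opnorm_le => x x1.
by rewrite /= normrM ler_wpM2l// dnorm_ub.
Qed.

Let dnormZ (a : R) f : dnorm (a *: f) = `|a| * dnorm f.
Proof.
apply/eqP; rewrite eq_le dnormZ_le /=.
have [->|a0] := eqVneq a 0.
  rewrite normr0 mul0r; apply: le_trans (dnorm_ub _ (x := 0) _) => //.
  by rewrite /unit_ball /= normr0.
rewrite -ler_pdivlMl ?normr_gt0// -normfV.
by rewrite -{1}(scalerK a0 f) dnormZ_le.
Qed.

Let dnorm0_eq0 f : dnorm f = 0 -> f = 0.
Proof.
move=> f0; apply: val_inj; apply/funext => x /=.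
have [->|x0] := eqVneq x 0; first by rewrite linear0.
apply/eqP; rewrite -normr_le0.
have := @dnorm_ub f (`|x|^-1 *: x); rewrite f0 linearZ/= normrM normfV normr_id.
rewrite pmulr_rle0 ?invr_gt0 ?normr_gt0//; apply.
by rewrite /unit_ball /= normrZ normfV normr_id mulVf// normr_eq0.
Qed.

HB.instance Definition _ :=
  Lmodule_isNormed.Build R (dual V) dnormD dnormZ dnorm0_eq0.

End dual_norm.

Lemma dual_normE (R : realType) (V : normedModType R) (f : dual V) :
  `|f| = opnorm f.
Proof. by []. Qed.

(* A linear subspace [Y] of [V] as a normed space for the induced norm. *)
Definition subsp (R : realType) (V : normedModType R) (Y : submodClosed V) :=
  {x : V | x \in Y}.

HB.instance Definition _ (R : realType) (V : normedModType R)
  (Y : submodClosed V) := SubChoice.on (subsp Y).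
HB.instance Definition _ (R : realType) (V : normedModType R)
  (Y : submodClosed V) := [SubChoice_isSubLmodule of subsp Y by <:].

Section subsp_norm.
Variables (R : realType) (V : normedModType R) (Y : submodClosed V).

Let snorm (x : subsp Y) : R := `|val x|.

Let snormD x y : snorm (x + y) <= snorm x + snorm y.
Proof. exact: ler_normD. Qed.

Let snormZ (a : R) x : snorm (a *: x) = `|a| * snorm x.
Proof. by rewrite /snorm linearZ/= normrZ. Qed.

Let snorm0_eq0 x : snorm x = 0 -> x = 0.
Proof. by move=> /normr0_eq0 x0; exact: val_inj. Qed.

HB.instance Definition _ :=
  Lmodule_isNormed.Build R (subsp Y) snormD snormZ snorm0_eq0.

End subsp_norm.

Lemma subsp_normE (R : realType) (V : normedModType R) (Y : submodClosed V)
  (x : subsp Y) : `|x| = `|val x|.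
Proof. by []. Qed.

Definition annihilator (R : realType) (V : normedModType R) (A : set V) :
  set (dual V) := [set f | forall y, A y -> f y = 0].

(* [opnorm P = 1] implies that [P] is bounded, see [opnorm]. *)
Definition is_ideal (R : realType) (V : normedModType R) (A : set V) : Prop :=
  exists P : {linear dual V -> dual V},
    [/\ forall f, P (P f) = P f,
        opnorm P = 1 &
        [set f | P f = 0] = annihilator A].

(* The scalars are real, so that [Re f] is [f]. *)
Definition slice (R : realType) (V : normedModType R) (f : dual V) (e : R) :
  set V := [set x | unit_ball V x /\
                    sup [set `|f c| | c in unit_ball V] - e < f x].

Definition is_slice (R : realType) (V : normedModType R) (S : set V) : Prop :=
  exists (f : dual V) (e : R), [/\ unit_ball (dual V) f, 0 < e & S = slice f e].

Definition is_convex_comb_slices (R : realType) (V : normedModType R)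
    (C : set V) : Prop :=
  exists (n : nat) (l : 'I_n -> R) (S : 'I_n -> set V),
    [/\ forall i, 0 < l i,
        \sum_(i < n) l i = 1,
        forall i, is_slice (S i) &
        C = [set \sum_(i < n) l i *: x i | x in
               [set x : 'I_n -> V | forall i, S i (x i)]]].

(* The weak topology: the coarsest one making every [f : dual V] continuous. *)
Definition weak_topology (R : realType) (V : normedModType R) : Type := V.

HB.instance Definition _ (R : realType) (V : normedModType R) :=
  Topological.copy (weak_topology V)
    (sup_topology (fun f : dual V =>
      Topological.class (initial_topology (dual_fun f)))).

Definition rel_weakly_open (R : realType) (V : normedModType R) (B W : set V) :
  Prop := exists U : set (weak_topology V), open U /\ W = B `&` U.

Definition property_P1bar (R : realType) (V : normedModType R) : Prop :=
  forall C : set V, is_convex_comb_slices C ->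
  forall x, C x ->
  exists W : set V,
    [/\ rel_weakly_open (unit_ball V) W, W x & W `<=` closure C].
Arguments property_P1bar {R} V.

(* Main.v *)
(* An ideal Y carries a linear extension operator phi : Y^* -> X^* of norm one:
   extend a functional by Hahn-Banach and apply the projection, whose kernel
   Y^perp makes the result independent of the extension.  Hence a point of a
   convex combination of the slices S(B_Y, f_i, e_i) lies in the corresponding
   combination of S(B_X, phi f_i, d_i) for some d_i < e_i, and the relatively
   weakly open set W given by property (P1bar) of X restricts to B_Y.  It
   remains to see that a point y of Y near sum_i l_i x_i, with x_i in B_X, is
   as near to some sum_i l_i z_i, with z_i in B_Y and f_i(z_i) close to
   (phi f_i)(x_i).  Otherwise a functional (g, c) on Y * R^n separates, and
   this contradicts |phi h_i| <= |h_i| for h_i = l_i g + c_i f_i. *)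
Require Import Defs.
From HB Require Import structures.
From mathcomp Require Import all_boot all_order all_algebra.
From mathcomp Require Import all_classical all_reals all_analysis.
From mathcomp Require Import ring lra.
Import Order.TTheory GRing.Theory Num.Theory.
Import numFieldNormedType.Exports.
Local Open Scope classical_set_scope.
Local Open Scope ring_scope.

(** * Sublinear functionals and Hahn-Banach with a cone constraint *)

Lemma le_inf_add (R : realType) (S T : set R) (c : R) :
  S !=set0 -> T !=set0 -> (forall s t, S s -> T t -> c <= s + t) ->
  c <= inf S + inf T.
Proof.
move=> S0 T0 cST; rewrite -lerBlDr; apply: lb_le_inf => // s Ss.
rewrite lerBlDr -lerBlDl; apply: lb_le_inf => // t Tt.
by rewrite lerBlDl cST.
Qed.

Definition sublinear (R : realType) (V : lmodType R) (p : V -> R) : Prop :=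
  (forall x y, p (x + y) <= p x + p y) /\
  (forall a x, 0 <= a -> p (a *: x) = a * p x).

Section sublinear_theory.
Variables (R : realType) (V : lmodType R).
Implicit Types (p q : V -> R) (K : set (V * R^o)).

Lemma sublinear_le p :
  (forall x y, p (x + y) <= p x + p y) ->
  (forall a x, 0 <= a -> p (a *: x) <= a * p x) -> sublinear R V p.
Proof.
move=> pD pZ; split=> // a x; rewrite le_eqVlt => /orP[/eqP <-|a0].
  have p0 : 0 <= p 0 by have := pD 0 0; rewrite addr0 lerDl.
  have := pZ 0 x (lexx _); rewrite scale0r mul0r => p0'.
  by apply/eqP; rewrite eq_le p0 p0'.
apply/eqP; rewrite eq_le (pZ _ _ (ltW a0))/= -ler_pdivlMl//.
rewrite -{1}(scalerK (lt0r_neq0 a0) x) pZ// invr_ge0 ltW//.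
Qed.

Lemma sublinear0 p : sublinear R V p -> p 0 = 0.
Proof. by move=> [_ pZ]; have := pZ 0 0 (lexx _); rewrite scale0r mul0r. Qed.

Lemma sublinear_geN p x : sublinear R V p -> - p (- x) <= p x.
Proof.
by move=> sp; rewrite -subr_ge0 opprK -(sublinear0 p sp) -(subrr x) sp.1.
Qed.

Definition convex_cone (W : lmodType R) (K : set W) : Prop :=
  [/\ K 0, forall v w, K v -> K w -> K (v + w) &
      forall a v, 0 <= a -> K v -> K (a *: v)].

(** Take [q x] to be the infimum of [p (x + v.1) - v.2] over [v] in [K]; it is finite because
    [v.2 <= p v.1 <= p (x + v.1) + p (- x)]. The bound at [- v.1] forces [v.2 <= l v.1] for every
    linear [l] below [q]. *)
Lemma sublinear_cone_minorant p K :
  sublinear R V p -> convex_cone _ K -> (forall v, K v -> v.2 <= p v.1) ->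
  exists q, [/\ sublinear R V q, forall x, q x <= p x &
                forall v, K v -> q (- v.1) <= - v.2].
Proof.
move=> sp [K0 KD KZ] Kp.
pose S x := [set p (x + v.1) - v.2 | v in K].
have S0 x : S x !=set0 by exists (p (x + 0) - 0), 0.
have Slb x : has_lbound (S x).
  exists (- p (- x)) => _ [v Kv <-].
  have := sp.1 (x + v.1) (- x); rewrite addrAC subrr add0r => h.
  by have := Kp v Kv; lra.
have infS x v : K v -> inf (S x) <= p (x + v.1) - v.2.
  by move=> Kv; apply: ge_inf => //; exists v.
exists (fun x => inf (S x)); split.
- apply: sublinear_le => [x y|a x a0].
    apply: le_inf_add => // _ _ [v Kv <-] [w Kw <-].
    apply: le_trans (infS _ _ (KD _ _ Kv Kw)) _ => /=.
    have := sp.1 (x + v.1) (y + w.1); rewrite addrACA; lra.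
  move: a0; rewrite le_eqVlt => /orP[/eqP <-|a0].
    rewrite scale0r mul0r; apply: le_trans (infS _ _ K0) _ => /=.
    by rewrite addr0 subr0 (sublinear0 p sp).
  rewrite -ler_pdivrMl//; apply: lb_le_inf => // _ [v Kv <-].
  rewrite ler_pdivrMl//.
  apply: le_trans (infS _ _ (KZ a _ (ltW a0) Kv)) _ => /=.
  by rewrite -scalerDr (sp.2 _ _ (ltW a0)) mulrBr.
- by move=> x; apply: le_trans (infS _ _ K0) _; rewrite /= addr0 subr0.
- move=> v Kv; apply: le_trans (infS _ _ Kv) _.
  by rewrite addNr (sublinear0 p sp) add0r.
Qed.

(* A pointwise minimal sublinear functional [q] is linear: by minimality it is
   not changed when [sublinear_cone_minorant] is applied to the ray through
   [(y, q y)], which gives [q (- y) <= - q y]. *)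
Lemma sublinear_ge_linear p :
  sublinear R V p -> exists l : {linear V -> R^o}, forall x, l x <= p x.
Proof.
move=> sp.
pose T := {q | sublinear R V q /\ forall x, q x <= p x}.
pose mk q (sq : sublinear R V q) (qp : forall x, q x <= p x) : T :=
  exist _ q (conj sq qp).
(* The order is reversed, so that a maximal element for Zorn's lemma is a pointwise minimal
   functional. *)
pose Le (q r : T) := `[< forall x, sval r x <= sval q x >].
have [| | | |[q [sq qp]] qmin] := @Zorn T Le.
- by move=> t; apply/asboolP.
- move=> r s t /asboolP rs /asboolP st; apply/asboolP => x.
  exact: le_trans (st x) (rs x).
- move=> [s ?] [t ?] /asboolP/= st /asboolP/= ts.
  apply: eq_exist; apply/funext => x.
  by apply/eqP; rewrite eq_le ts st.
- move=> A Atot.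
  have [->|/set0P[r0 Ar0]] := eqVneq A set0.
    by exists (mk p sp (fun x => lexx _)).
  pose S x := [set sval r x | r in A].
  have S0 x : S x !=set0 by exists (sval r0 x), r0.
  have Slb x : has_lbound (S x).
    exists (- p (- x)) => _ [[r [sr rp]] Ar <-] /=.
    by apply: le_trans (sublinear_geN _ x sr); rewrite lerN2.
  have infS x r : A r -> inf (S x) <= sval r x.
    by move=> Ar; apply: ge_inf => //; exists r.
  have sinf : sublinear R V (fun x => inf (S x)).
    apply: sublinear_le => [x y|a x].
      apply: le_inf_add => // _ _ [r Ar <-] [s As <-].
      have [/asboolP rs|/asboolP sr] := Atot _ _ Ar As.
        apply: le_trans (infS _ _ As) _; apply: le_trans ((svalP s).1.1 _ _) _.
        exact: lerD.
      apply: le_trans (infS _ _ Ar) _; apply: le_trans ((svalP r).1.1 _ _) _.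
      exact: lerD.
    rewrite le_eqVlt => /orP[/eqP <-|a0].
      apply: le_trans (infS _ _ Ar0) _; rewrite scale0r mul0r.
      by rewrite (sublinear0 _ (svalP r0).1).
    rewrite -ler_pdivrMl//; apply: lb_le_inf => // _ [r Ar <-].
    rewrite ler_pdivrMl//; apply: le_trans (infS _ _ Ar) _.
    by rewrite ((svalP r).1.2 _ _ (ltW a0)).
  have infp x : inf (S x) <= p x.
    by apply: le_trans (infS _ _ Ar0) _; exact: (svalP r0).2.
  exists (mk _ sinf infp) => s As; apply/asboolP => x.
  exact: infS.
have qN y : q (- y) = - q y.
  apply/eqP; rewrite eq_le [X in _ && X]lerNl sublinear_geN// andbT.
  pose K : set (V * R^o) := [set (t *: y, t * q y) | t in [set t | 0 <= t]].
  have [||//|r [sr rq rK]] := sublinear_cone_minorant q K.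
  - by [].
  - split.
    + by exists 0 => //=; rewrite scale0r mul0r.
    + move=> _ _ [t t0 <-] [s s0 <-]; exists (t + s); first exact: addr_ge0.
      by rewrite scalerDl mulrDl.
    + move=> a _ a0 [t t0 <-]; exists (a * t); first exact: mulr_ge0.
      by rewrite -scalerA -mulrA.
  - by move=> _ [t t0 <-] /=; rewrite sq.2.
  have rp x : r x <= p x by exact: le_trans (rq x) (qp x).
  have rE : r = q.
    have /qmin := asboolT rq : Le (mk q sq qp) (mk r sr rp).
    by move/(congr1 sval).
  rewrite -{1}rE; have := rK (1 *: y, 1 * q y); rewrite /= scale1r mul1r.
  by apply; exists 1; rewrite /= ?scale1r ?mul1r.
have qD x y : q (x + y) = q x + q y.
  apply/eqP; rewrite eq_le sq.1/=.
  have := sq.1 (x + y) (- y); rewrite addrK qN; lra.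
have lq : linear (q : V -> R^o).
  move=> a x y; rewrite qD; congr (_ + _).
  have [a0|a0] := leP 0 a; first exact: sq.2.
  have Na0 : 0 <= - a by rewrite oppr_ge0 ltW.
  by rewrite -{1}[a]opprK scaleNr qN (sq.2 _ _ Na0) mulNr opprK.
pose L := GRing.isLinear.Build R V R^o _ q lq.
pose l : {linear V -> R^o} := HB.pack q L.
by exists l.
Qed.

(** This form of Hahn-Banach serves twice: with the graph of a functional as [K] it extends, with
    the cone over a convex set it separates. *)
Lemma sublinear_cone_linear p K :
  sublinear R V p -> convex_cone _ K -> (forall v, K v -> v.2 <= p v.1) ->
  exists l : {linear V -> R^o},
    (forall x, l x <= p x) /\ (forall v, K v -> v.2 <= l v.1).
Proof.
move=> sp cK Kp; have [q [sq qp qK]] := sublinear_cone_minorant p K sp cK Kp.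
have [l lq] := sublinear_ge_linear q sq.
exists l; split=> [x|v /qK qv]; first exact: le_trans (lq x) (qp x).
by rewrite -lerN2 -linearN; exact: le_trans (lq _) qv.
Qed.

(** The cone generated by [D] placed at height 1 is convex since [D] is, and homogeneity of [p]
    turns [1 <= p v] on [D] into domination on the whole cone. *)
Lemma sublinear_separation p (D : set V) :
  sublinear R V p ->
  (forall a v w, 0 <= a <= 1 -> D v -> D w -> D (a *: v + (1 - a) *: w)) ->
  (forall v, D v -> 1 <= p v) ->
  exists l : {linear V -> R^o},
    (forall x, l x <= p x) /\ (forall v, D v -> 1 <= l v).
Proof.
move=> sp cD Dp.
pose K : set (V * R^o) := [set w | w = 0 \/ exists t v,
  [/\ 0 < t, D v & w = (t *: v, t)]].
have [||l [lp lK]] := sublinear_cone_linear p K sp.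
- split; first by left.
  + move=> _ w [-> Kw|[t [v [t0 Dv ->]]] [->|[s [u [s0 Du ->]]]]].
    * by rewrite add0r.
    * by rewrite addr0; right; exists t, v.
    (* [t *: v + s *: u] is [t + s] times a convex combination of [v] and [u]. *)
    * right; exists (t + s), ((t / (t + s)) *: v + (1 - t / (t + s)) *: u).
      have ts0 : 0 < t + s by rewrite addr_gt0.
      split=> //.
        apply: cD => //; rewrite ler_pdivrMr// mul1r lerDl (ltW s0) andbT.
        by apply: divr_ge0; exact: ltW.
      rewrite scalerDr !scalerA mulrBr mulr1 mulrCA mulfV ?gt_eqF// mulr1.
      by rewrite addrAC subrr add0r.
  + move=> a w; rewrite le_eqVlt => /orP[/eqP <- _|a0 [->|[t [v [t0 Dv ->]]]]].
    * by left; rewrite scale0r.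
    * by left; rewrite scaler0.
    * by right; exists (a * t), v; split=> //;
        [exact: mulr_gt0|rewrite -scalerA].
- move=> _ [->|[t [v [t0 Dv ->]]]] /=; first by rewrite (sublinear0 p sp).
  by rewrite (sp.2 _ _ (ltW t0)) ler_peMr ?Dp// ltW.
exists l; split=> // v Dv.
have := lK (1 *: v, 1); rewrite /= scale1r; apply.
by right; exists 1, v; rewrite scale1r.
Qed.

End sublinear_theory.

(** * Norm estimates for functionals *)

Section dual_theory.
Variables (R : realType) (V : normedModType R).

Lemma dual_linE (a : R) (f g : dual V) x : (a *: f + g) x = a * f x + g x.
Proof. by []. Qed.

Lemma le_dual (f : dual V) (x : V) : `|f x| <= `|f| * `|x|.
Proof.
have [->|x0] := eqVneq x 0; first by rewrite linear0 !normr0 mulr0.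
have nx : 0 < `|x| by rewrite normr_gt0.
have xE : x = `|x| *: (`|x|^-1 *: x) by rewrite scalerA mulfV ?gt_eqF// scale1r.
rewrite {1}xE linearZ/= normrM normr_id mulrC ler_pM2r//.
apply: opnorm_ub; first exact: dual_continuous.
by rewrite /unit_ball/= normrZ normfV normr_id mulVf ?gt_eqF.
Qed.

Lemma dual_approx_norm (f : dual V) (e : R) :
  0 < e -> exists2 x, unit_ball V x & `|f| - e < f x.
Proof.
move=> e0; have B0 : unit_ball V 0 by rewrite /unit_ball/= normr0.
have [||_ [x x1 <-] fx] := @sup_adherent _ [set `|f x| | x in unit_ball V] e.
- exact: e0.
- split; first by exists `|f 0|, 0.
  exists `|f| => _ [x x1 <-]; apply: opnorm_ub => //; exact: dual_continuous.
(* The supremum concerns [|f x|]; replacing [x] by [- x] removes the absolute value. *)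
move: fx; have [f0|f0] := leP 0 (f x).
  by rewrite (ger0_norm f0); exists x.
rewrite (ltr0_norm f0) -linearN; exists (- x) => //.
by rewrite /unit_ball/= normrN.
Qed.

Lemma dual_of_le (l : {linear V -> R^o}) (M : R) : 0 <= M ->
  (forall x, l x <= M * `|x|) ->
  exists2 f : dual V, forall x, f x = l x & `|f| <= M.
Proof.
move=> M0 lM.
have lM' x : `|l x| <= M * `|x|.
  by rewrite ler_norml lM andbT lerNl -linearN -(normrN x) lM.
have cl : continuous l.
  apply/linear_bounded_continuous/bounded_funP => r.
  by exists (M * r) => x xr; apply: le_trans (lM' x) _; rewrite ler_wpM2l.
have lP : (l : V -> R^o) \in @dual_pred R V.
  by apply/asboolP; split=> //; exact: linearP.
exists (Dual lP) => //; apply: opnorm_le => x x1 /=.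
by apply: le_trans (lM' x) _; rewrite ler_piMr.
Qed.

Lemma sublinear_norm (c : R) : 0 <= c -> sublinear R V (fun x => c * `|x|).
Proof.
move=> c0; split=> [x y|a x a0]; first by rewrite -mulrDr ler_wpM2l ?ler_normD.
by rewrite normrZ ger0_norm// mulrCA.
Qed.

End dual_theory.

(** * Hahn-Banach extensions and the extension operator of an ideal *)

Lemma dual_extension (R : realType) (X : normedModType R) (Y : submodClosed X)
  (h : dual (subsp Y)) :
  exists2 H : dual X, forall y, H (val y) = h y & `|H| <= `|h|.
Proof.
pose K : set (X * R^o) := [set (val y, h y) | y in [set: subsp Y]].
have [|||l [lh lK]] := sublinear_cone_linear R X (fun x => `|h| * `|x|) K.
- exact: sublinear_norm.
- split.
  + by exists 0 => //; rewrite !linear0.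
  + by move=> _ _ [y _ <-] [z _ <-]; exists (y + z); rewrite ?linearD.
  + by move=> a _ _ [y _ <-]; exists (a *: y); rewrite ?linearZ.
- move=> _ [y _ <-] /=; apply: le_trans (ler_norm _) _; exact: le_dual.
have [//|H Hl Hh] := dual_of_le R X l `|h| _ lh.
exists H => // y; rewrite Hl; apply/eqP; rewrite eq_le.
(* The graph is a subspace, so the inequality at [y] and at [- y] gives equality. *)
have lK' z : h z <= l (val z) by apply: (lK (val z, h z)); exists z.
by rewrite lK' andbT -lerN2 -!linearN; exact: lK' (- y).
Qed.

Lemma ideal_extension_operator (R : realType) (X : normedModType R)
  (Y : submodClosed X) : is_ideal [set x : X | x \in Y] ->
  exists phi : {linear dual (subsp Y) -> dual X},
    (forall f y, phi f (val y) = f y) /\ (forall f, `|phi f| <= `|f|).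
Proof.
move=> [P [PP P1 kerP]].
have PE (f g : dual X) : (forall y : subsp Y, f (val y) = g (val y)) ->
    P f = P g.
  move=> fg; apply/eqP; rewrite -subr_eq0 -linearB; apply/eqP.
  have : [set f | P f = 0] (f - g).
    rewrite kerP => x Yx; apply/eqP; rewrite subr_eq0.
    by apply/eqP; exact: (fg (exist _ x Yx)).
  by [].
(* As [P] is idempotent, [P f - f] lies in its kernel, hence vanishes on [Y]. *)
have PY f (y : subsp Y) : P f (val y) = f (val y).
  have : annihilator [set x : X | x \in Y] (P f - f).
    by rewrite -kerP /= linearB/= PP subrr.
  by move=> /(_ (val y) (valP y)) /eqP; rewrite subr_eq0 => /eqP.
have Ple f : `|P f| <= `|f|.
  (* An unbounded set would have supremum 0 by convention, against [opnorm P = 1]. *)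
  have supP : has_sup [set `|P f| | f in unit_ball (dual X)].
    apply/not_notP => nsup; have := P1; rewrite /opnorm sup_out//.
    by move/esym/eqP; rewrite oner_eq0.
  have [->|f0] := eqVneq f 0; first by rewrite linear0 !normr0.
  have nf : 0 < `|f| by rewrite normr_gt0.
  have : `|P (`|f|^-1 *: f)| <= opnorm P.
    apply: ub_le_sup; first exact: supP.2.
    exists (`|f|^-1 *: f) => //.
    by rewrite /unit_ball/= normrZ normfV normr_id mulVf ?gt_eqF.
  rewrite P1 linearZ/= normrZ normfV normr_id.
  by rewrite mulrC ler_pdivrMr// mul1r.
have /choice[ext extE] (f : dual (subsp Y)) : exists F : dual X,
    (forall y, F (val y) = f y) /\ `|F| <= `|f|.
  by have [F FE Ff] := dual_extension R X Y f; exists F.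
(* The chosen [ext] need not be linear, but [P] depends only on values on [Y], where [ext] respects
   linear combinations. *)
have lin : linear (fun f => P (ext f)).
  move=> a f g; rewrite -linearP; apply: PE => y.
  by rewrite !dual_linE !(extE _).1 dual_linE.
pose L := GRing.isLinear.Build R (dual (subsp Y)) (dual X) _ _ lin.
pose phi : {linear dual (subsp Y) -> dual X} := HB.pack (fun f => P (ext f)) L.
exists phi; split=> [f y|f] /=; first by rewrite PY (extE f).1.
exact: le_trans (Ple _) (extE f).2.
Qed.

(** * Simultaneous approximation by points of the ideal *)

Lemma ideal_local_approx (R : realType) (X : normedModType R)
  (Y : submodClosed X) (phi : {linear dual (subsp Y) -> dual X})
  (n : nat) (l d : 'I_n -> R) (f : 'I_n -> dual (subsp Y)) (y : subsp Y)
  (x : 'I_n -> X) (r : R) :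
  (forall g z, phi g (val z) = g z) -> (forall g, `|phi g| <= `|g|) ->
  (forall i, unit_ball X (x i)) -> (forall i, 0 < d i) ->
  `|val y - \sum_(i < n) l i *: x i| < r ->
  exists z : 'I_n -> subsp Y,
    [/\ forall i, unit_ball (subsp Y) (z i),
        `|y - \sum_(i < n) l i *: z i| < r &
        forall i, `|phi (f i) (x i) - f i (z i)| < d i].
Proof.
move=> phiY phi1 x1 d0 yr.
have r0 : 0 < r := le_lt_trans (normr_ge0 _) yr.
apply/not_existsP => noz.
pose E : lmodType R := (subsp Y * ('I_n -> R^o))%type.
(* The weights are such that [p w < 1] forces [|w.1| < r] and every [|w.2 i| < d i]. Hence, if no
   [z] works, [p >= 1] on the convex set [D] of all defects. *)
pose p (w : E) := r^-1 * `|w.1| + \sum_(i < n) (d i)^-1 * `|w.2 i|.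
have sp : sublinear R E p.
  split=> [v w|a w a0]; rewrite /p.
    rewrite addrACA -big_split/= lerD//.
      by rewrite -mulrDr ler_wpM2l ?ler_normD// invr_ge0 ltW.
    apply: ler_sum => i _.
    by rewrite -mulrDr ler_wpM2l ?ler_normD// invr_ge0 ltW.
  rewrite mulrDr mulr_sumr; congr (_ + _).
    by rewrite /= normrZ ger0_norm// mulrCA.
  by apply: eq_bigr => i _; rewrite /= normrM ger0_norm// mulrCA.
pose D : set E := [set (y - \sum_(i < n) l i *: z i,
    fun i => phi (f i) (x i) - f i (z i))
  | z in [set z : 'I_n -> subsp Y | forall i, unit_ball _ (z i)]].
have [|v Dv|L [Lp LD]] := sublinear_separation R E p D sp.
- move=> a _ _ /andP[a0 a1] [z z1 <-] [w w1 <-].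
  exists (fun i => a *: z i + (1 - a) *: w i).
    move=> i; rewrite /unit_ball/=; apply: le_trans (ler_normD _ _) _.
    rewrite !normrZ (ger0_norm a0) ger0_norm ?subr_ge0//.
    have := ler_wpM2l a0 (z1 i); have : (1 - a) * `|w i| <= (1 - a) * 1.
      by rewrite ler_wpM2l ?subr_ge0//; exact: w1.
    lra.
  congr pair => /=.
    rewrite !scalerBr addrACA -scalerDl [a + _]addrC subrK scale1r -opprD.
    congr (_ - _); rewrite !scaler_sumr -big_split/=; apply: eq_bigr => i _.
    by rewrite scalerDr !scalerA ![l i * _]mulrC.
  apply/funext => i; rewrite linearD/= !linearZ/= !fctE/=.
  rewrite /GRing.scale/=; ring.
- case: Dv => z z1 <-; rewrite leNgt; apply/negP => pz; apply: (noz z).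
  have sum0 (P : pred 'I_n) : 0 <= \sum_(i < n | P i)
      (d i)^-1 * `|phi (f i) (x i) - f i (z i)|.
    by apply: sumr_ge0 => i _; rewrite mulr_ge0// invr_ge0 ltW.
  split=> // [|i].
    rewrite -[r]mulr1 -ltr_pdivrMl//; apply: le_lt_trans pz.
    by rewrite /p/= lerDl.
  rewrite -[d i]mulr1 -ltr_pdivrMl//; apply: le_lt_trans pz.
  rewrite /p/= [X in _ <= _ + X](bigD1 i)//= addrCA lerDl addr_ge0//.
  by rewrite mulr_ge0// invr_ge0 ltW.
have linL1 : linear (fun u : subsp Y => L (u, 0) : R^o).
  move=> a u v; rewrite -linearP; congr (L _); congr pair.
  by rewrite /= scaler0 addr0.
pose L1 : {linear subsp Y -> R^o} :=
  HB.pack (fun u : subsp Y => L (u, 0) : R^o)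
    (GRing.isLinear.Build R (subsp Y) R^o _ _ linL1).
have [||g gL gr] := dual_of_le R _ L1 r^-1.
- by rewrite invr_ge0 ltW.
- move=> u; apply: le_trans (Lp _) _; rewrite /p/= big1 ?addr0// => i _.
  by rewrite normr0 mulr0.
(* The separating [L] splits into [g] on [Y], of norm at most [r^-1], and coefficients [c] on the
   coordinates. *)
pose c i := L (0, fun j => (i == j)%:R).
have LE u a : L (u, a) = g u + \sum_(i < n) a i * c i.
  have -> : (u, a) = ((u, 0) : E) +
      \sum_(i < n) a i *: ((0, fun j => (i == j)%:R) : E).
    apply: injective_projections => /=.
      by rewrite raddf_sum/= big1 ?addr0// => i _; rewrite scaler0.
    rewrite raddf_sum/= add0r; apply/funext => j; rewrite fct_sumE.
    rewrite (bigD1 j)//= big1 => [|i /negbTE ij]; rewrite !fctE.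
      by rewrite eqxx addr0 [_ *: _]mulr1.
    by rewrite ij scaler0.
  rewrite linearD gL linear_sum; congr (_ + _).
  by apply: eq_bigr => i _; rewrite linearZ.
pose h i : dual (subsp Y) := l i *: g + c i *: f i.
(* [s] bounds the value of [phi g] at the error vector and is below 1. Dividing the slack [1 - s] by
   [n.+1] keeps the sum of [n] errors [e] strictly below it, also for [n = 0]. *)
pose s := r^-1 * `|val y - \sum_(i < n) l i *: x i|.
have s1 : s < 1 by rewrite /s ltr_pdivrMl// mulr1.
pose e := (1 - s) / n.+1%:R.
have e0 : 0 < e by rewrite divr_gt0// subr_gt0.
(* Points [z i] almost norming [h i] make [phi (h i) (x i) - h i (z i) < e], so that [L] is below 1
   at their defect. *)
have /choice[z zE] i : exists z, unit_ball _ z /\ `|h i| - e < h i z.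
  by have [z z1 hz] := dual_approx_norm R _ (h i) e e0; exists z.
have := LD _ (imageP _ (fun i => (zE i).1) : D _).
apply/negP; rewrite -ltNge LE.
(* Since [phi g] agrees with [g] on [Y], adding and subtracting the terms [l i * phi g (x i)]
   regroups everything by [h i]. *)
have -> : g (y - \sum_(i < n) l i *: z i) +
    \sum_(i < n) (phi (f i) (x i) - f i (z i)) * c i =
  phi g (val y - \sum_(i < n) l i *: x i) +
    \sum_(i < n) (phi (h i) (x i) - h i (z i)).
  have hz i : h i (z i) = l i * g (z i) + c i * f i (z i) by [].
  have hx i : phi (h i) (x i) = l i * phi g (x i) + c i * phi (f i) (x i).
    by rewrite /h linearD !linearZ.
  have gE : g (y - \sum_(i < n) l i *: z i) = g y - \sum_(i < n) l i * g (z i).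
    rewrite linearB linear_sum; congr (_ - _).
    by apply: eq_bigr => i _; rewrite linearZ.
  have phigE : phi g (val y - \sum_(i < n) l i *: x i) =
      g y - \sum_(i < n) l i * phi g (x i).
    rewrite linearB linear_sum/= phiY; congr (_ - _).
    by apply: eq_bigr => i _; rewrite linearZ.
  rewrite gE phigE -!addrA; congr (_ + _).
  rewrite -!sumrN -!big_split; apply: eq_bigr => i _.
  by rewrite hx hz /=; ring.
apply: (@le_lt_trans _ _ (s + \sum_(i < n) e)).
  apply: lerD.
    apply: le_trans (ler_norm _) _; apply: le_trans (le_dual _ _ _ _) _.
    by rewrite ler_wpM2r// (le_trans (phi1 g)).
  apply: ler_sum => i _.
  have := le_trans (ler_norm _) (le_dual _ _ (phi (h i)) (x i)).
  have := ler_wpM2l (normr_ge0 (phi (h i))) (x1 i).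
  have := phi1 (h i); have := (zE i).2; rewrite mulr1; lra.
have en : e * n%:R < 1 - s.
  rewrite /e -mulrA gtr_pMr ?subr_gt0// mulrC ltr_pdivrMr ?ltr0Sn//.
  by rewrite mul1r ltr_nat.
by rewrite sumr_const card_ord -mulr_natr; lra.
Qed.

(** * Weak continuity of the inclusion of a subspace *)

Lemma weak_continuous (R : realType) (V W : normedModType R) (j : V -> W) :
  (forall f : dual W, exists g : dual V, forall v, f (j v) = g v) ->
  continuous (j : weak_topology V -> weak_topology W).
Proof.
move=> jdual v; apply/cvg_sup => [|f A].
  exact: fmap_filter (nbhs_filter (v : weak_topology V)).
move=> [_ [[C oC <-] Cv] CA].
have [g gE] := jdual f.
(* In the supremum topology it suffices to treat one [f] at a time; the preimage of [f @^-1]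
   C[under]j[is]g @^-1[C]. *)
have gA : nbhs (v : initial_topology g) (j @^-1` A).
  rewrite nbhsE; exists (g @^-1` C); first by split; [exists C|rewrite /= -gE].
  by move=> u Cu; apply: CA; rewrite /= gE.
have /cvg_sup gv : nbhs (v : weak_topology V) --> (v : weak_topology V).
  exact: cvg_id.
exact: (gv g _ gA).
Qed.

Lemma weak_continuous_val (R : realType) (X : normedModType R)
  (Y : submodClosed X) :
  continuous (val : weak_topology (subsp Y) -> weak_topology X).
Proof.
apply: weak_continuous => f.
have lin : linear (fun y : subsp Y => f (val y)).
  by move=> a y z; rewrite linearP.
pose l : {linear subsp Y -> R^o} := HB.pack (fun y : subsp Y => f (val y))
  (GRing.isLinear.Build R (subsp Y) R^o _ _ lin).
have [//||g gl _] := dual_of_le R _ l `|f|; last by exists g.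
by move=> y; apply: le_trans (ler_norm _) _; exact: le_dual.
Qed.

(** * Transfer of the property to an ideal *)

Theorem proposition2p12 (R : realType) (X : completeNormedModType R)
  (hX : property_P1bar X)
  (Y : submodClosed X) (hYclosed : closed [set x : X | x \in Y])
  (hY : is_ideal [set x : X | x \in Y]) :
  property_P1bar (subsp Y).
Proof.
have [phi [phiY phi1]] := ideal_extension_operator R X Y hY.
(* Equal norms give the slices of [f] and [phi f] the same reference level. *)
have normphi f : `|phi f| = `|f|.
  apply/eqP; rewrite eq_le phi1/=; apply: opnorm_le => y y1.
  by rewrite -phiY; apply: opnorm_ub => //; exact: dual_continuous.
move=> _ [n [l [S [l0 l1 Sslice ->]]]] _ [y Sy <-].
have /choice[fe feE] i : exists fe : dual (subsp Y) * R,
    [/\ unit_ball (dual (subsp Y)) fe.1, 0 < fe.2 & S i = slice fe.1 fe.2].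
  by have [f [e [f1 e0 SE]]] := Sslice i; exists (f, e).
pose f i := (fe i).1; pose e i := (fe i).2.
have SE i z : S i z <-> unit_ball _ z /\ `|f i| - e i < f i z.
  by have [_ _ ->] := feE i.
(* The midpoint between the deficit of [y i] and [e i]: the narrower slice still contains [y i], and
   a margin [e i - d i] remains. *)
pose d i := (e i + (`|f i| - f i (y i))) / 2.
have d0 i : 0 < d i.
  have [_ + _] := feE i; rewrite -/(e i) => e0.
  have := le_trans (ler_norm _) (le_dual _ _ (f i) (y i)).
  have [y1 _] := (SE i (y i)).1 (Sy i).
  have := ler_wpM2l (normr_ge0 (f i)) y1; rewrite mulr1 /d; lra.
pose S' i := slice (phi (f i)) (d i).
have S'E i z : S' i z <-> unit_ball _ z /\ `|f i| - d i < phi (f i) z.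
  by rewrite -normphi.
pose C' := [set \sum_(i < n) l i *: x i | x in
               [set x : 'I_n -> X | forall i, S' i (x i)]].
have [||W [[U [oU WE]] Wy WC]] := hX C' _ (val (\sum_(i < n) l i *: y i)).
- exists n, l, S'; split=> // i; exists (phi (f i)), (d i); split=> //.
  by rewrite /unit_ball/= normphi; have [] := feE i.
- exists (fun i => val (y i)).
    move=> i; apply/S'E; have [y1 fy] := (SE i (y i)).1 (Sy i).
    by split=> //; rewrite phiY /d; lra.
  by rewrite linear_sum; apply: eq_bigr => i _; rewrite linearZ.
exists (unit_ball (subsp Y) `&` val @^-1` U); split.
- exists (val @^-1` U); split=> //.
  by move/continuousP: (@weak_continuous_val R X Y); apply.
- by move: Wy; rewrite WE.
move=> z [z1 Uz] B /nbhs_ballP[r /= r0 rB].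
have Wz : W (val z) by rewrite WE.
have [_ [[x S'x <-] /= xr]] := WC _ Wz _ (nbhsx_ballx (val z) r r0).
have de i : 0 < e i - d i.
  by have [_ fy] := (SE i (y i)).1 (Sy i); rewrite /d; lra.
have x1 i : unit_ball X (x i) by have [] := (S'E i (x i)).1 (S'x i).
have xr' : `|val z - \sum_(i < n) l i *: x i| < r.
  by move: xr; rewrite -ball_normE.
(* The margin is spent here: [f i (u i)] exceeds [phi (f i) (x i) - (e i - d i)], hence
   [|f i| - e i]. *)
have [u [u1 ur fu]] := ideal_local_approx R X Y phi n l (fun i => e i - d i)
  f z x r phiY phi1 x1 de xr'.
exists (\sum_(i < n) l i *: u i); split; last first.
  by apply: rB; rewrite -ball_normE.
exists u => // i; apply/SE; split=> //.
have [_ fx] := (S'E i (x i)).1 (S'x i).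
have := fu i; rewrite ltr_norml => /andP[_]; lra.
Qed.
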